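(* Let $n\ge 2$, $\alpha>0$, $0<\lambda\le\Lambda<\infty$, $0<\delta<1$, $s>0$. There exist constants $C>0$ and $R\ge1$ depending only on $\alpha,\delta,s,n$ such that the following holds. Let $a_{ij},a_{in}\in C(\mathbb{R}^n_+)$ ($1\le i,j\le n-1$) satisfy $$\lambda|\xi|^2\le \sum_{i,j=1}^{n-1}a_{ij}(x)\xi_i\xi_j\le\Lambda|\xi|^2\quad\text{for all }\xi\in\mathbb{R}^{n-1},\ x\in\mathbb{R}^n_+,$$ $$1-\lambda^{-1}\sum_{i=1}^{n-1}\|a_{in}\|_{L^\infty(\mathbb{R}^n_+)}^2>\delta ,$$ $$|a_{ij}(x)-\delta_{ij}|+|a_{in}(x)|\le d(x)^{-s}\quad\text{for all }x\in\mathbb{R}^n_+\setminus\overline{B_1^+},\ 1\le i,j\le n-1,$$ and let $$Lu=x_n^{2\alpha}\sum_{i,j=1}^{n-1}a_{ij}(x)D_{ij}u+2x_n^{\alpha}\sum_{i=1}^{n-1}a_{in}(x)D_{in}u+D_{nn}u .$$ Let $u\in C^1(\{x: x_n\ge0,\ |x|\ge1\})$ be a viscosity solution of $Lu=0$ in $\mathbb{R}^n_+\setminus\overline{B_1^+}$ with $u=0$ on $\{x_n=0,\ |x|\ge1\}$. Assume that $|u|\le1$ on $\partial B_1\cap\{x_n>0\}$, that $|Du|\le1$ on $\{x_n\ge0,\ |x|\ge1\}$, and that $|Du(x)|\to0$ as $|x|\to\infty$. Then $$|u(x)|\le\frac{C\,x_n}{d(x)^{Q}}\quad\text{for all }x\text{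 with }x_n\ge0,\ |x|\ge R .$$
   Context: Points of $\mathbb{R}^n$ are written $x=(x',x_n)$ with $x'\in\mathbb{R}^{n-1}$. $\mathbb{R}^n_+=\{x_n>0\}$, $B_r=\{|x|<r\}$, $B_r^+=B_r\cap\mathbb{R}^n_+$; $\delta_{ij}$ is the Kronecker delta (unrelated to the constant $\delta$). The gauge function is $$d(x)=\Big\{|x'|^2+\tfrac{1}{(\alpha+1)^2}x_n^{2(\alpha+1)}\Big\}^{\frac{1}{2(\alpha+1)}},$$ and $Q=(\alpha+1)(n-1)+1$. Solutions are understood in the standard ($C$-)viscosity sense. *)

(* Defs.v *)
From HB Require Import structures.
From mathcomp Require Import all_boot all_order all_algebra.
From mathcomp Require Import all_classical all_reals all_analysis.
Import Order.TTheory GRing.Theory Num.Theory.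
Import numFieldNormedType.Exports.

Set Implicit Arguments.
Unset Strict Implicit.
Unset Printing Implicit Defensive.

Local Open Scope classical_set_scope.
Local Open Scope ring_scope.

(* R^n is 'rV[R]_m.+1 with m = n - 1; the last coordinate x_n has index
   ord_max and x' collects the coordinates lift ord_max i for i < m. *)

Section Geometry.
Context {R : realType}.

(* The library norm `|x| on row vectors is the sup norm, hence this one. *)
Definition enorm k (x : 'rV[R]_k) : R := Num.sqrt (\sum_(i < k) x 0 i ^+ 2).

Context {m : nat}.
Implicit Types (x : 'rV[R]_m.+1) (r : R).

Definition xlast x : R := x 0 ord_max.
Definition xprime x : 'rV[R]_m := \row_(i < m) x 0 (lift ord_max i).

Definition half_space : set 'rV[R]_m.+1 := [set x | 0 < xlast x].
Definition half_ball r : set 'rV[R]_m.+1 := [set x | enorm x < r] `&` half_space.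

Definition ext_domain : set 'rV[R]_m.+1 := half_space `\` closure (half_ball 1).
Definition ext_closed r : set 'rV[R]_m.+1 :=
  [set x | 0 <= xlast x /\ r <= enorm x].

(* Only meaningful for x_n >= 0. *)
Definition gauge (alpha : R) x : R :=
  (enorm (xprime x) ^+ 2
    + ((alpha + 1) ^+ 2)^-1 * xlast x `^ (2 * (alpha + 1)))
  `^ (2 * (alpha + 1))^-1.

Definition hom_dim (alpha : R) : R := (alpha + 1) * m%:R + 1.

End Geometry.

Arguments half_space {R m}.
Arguments ext_domain {R m}.
Arguments hom_dim {R} m alpha.

Section LinftyNorm.
Context {R : realType} {k : nat}.

Definition box (a b : 'rV[R]_k) : set 'rV[R]_k :=
  [set x | forall i, a 0 i <= x 0 i <= b 0 i].

Definition box_volume (a b : 'rV[R]_k) : R := \prod_(i < k) (b 0 i - a 0 i).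

(* The library has no Lebesgue measure on R^k; null sets are those of zero
   outer measure with respect to countable covers by boxes. *)
Definition lebesgue_null (A : set 'rV[R]_k) : Prop :=
  forall e : R, 0 < e -> exists a b : nat -> 'rV[R]_k,
    [/\ forall l i, a l 0 i <= b l 0 i,
        A `<=` \bigcup_l box (a l) (b l)
      & (\sum_(0 <= l <oo) (box_volume (a l) (b l))%:E <= e%:E)%E].

(* Equal to +oo when f is not essentially bounded on A. *)
Definition Linfty_norm (A : set 'rV[R]_k) (f : 'rV[R]_k -> R) : \bar R :=
  ereal_inf [set M%:E | M in
    [set M : R | 0 <= M /\ lebesgue_null [set x | A x /\ M < `|f x|]]].

End LinftyNorm.

Section Regularity.
Context {R : realType} {m : nat}.
Implicit Types (u phi : 'rV[R]_m.+1 -> R) (A : set 'rV[R]_m.+1).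

Definition evec (i : 'I_m.+1) : 'rV[R]_m.+1 := delta_mx 0 i.

Definition pderiv2 (i j : 'I_m.+1) phi (x : 'rV[R]_m.+1) : R :=
  'D_(evec j) ('D_(evec i) phi) x.

(* Intended for open A. *)
Definition C2 A phi : Prop :=
  [/\ {within A, continuous phi},
      forall i, (forall x, A x -> derivable phi x (evec i)) /\
                {within A, continuous 'D_(evec i) phi}
    & forall i j, (forall x, A x -> derivable ('D_(evec i) phi) x (evec j)) /\
                  {within A, continuous (pderiv2 i j phi)}].

(* C^1 up to the boundary, for E the closure of its interior: u is continuous
   on E and its gradient in the interior extends continuously to E. The
   extension Du is determined on E by u. *)
Definition C1_closed (E : set 'rV[R]_m.+1) u
    (Du : 'rV[R]_m.+1 -> 'rV[R]_m.+1) : Prop :=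
  [/\ {within E, continuous u},
      {within E, continuous Du}
    & forall x i, E° x -> is_derive x (evec i) u (Du x 0 i)].

End Regularity.

Section Viscosity.
Context {R : realType} {m : nat}.
Variables (alpha : R) (a : 'I_m -> 'I_m -> 'rV[R]_m.+1 -> R)
          (b : 'I_m -> 'rV[R]_m.+1 -> R).
Implicit Types (u phi : 'rV[R]_m.+1 -> R) (A : set 'rV[R]_m.+1).

(* b i stands for a_{in}. *)
Definition Lop phi (x : 'rV[R]_m.+1) : R :=
  xlast x `^ (2 * alpha) *
    (\sum_(i < m) \sum_(j < m)
       a i j x * pderiv2 (lift ord_max i) (lift ord_max j) phi x)
  + 2 * xlast x `^ alpha *
    (\sum_(i < m) b i x * pderiv2 (lift ord_max i) ord_max phi x)
  + pderiv2 ord_max ord_max phi x.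

Definition viscosity_subsolution A u : Prop :=
  forall phi x0, C2 A phi -> A x0 ->
    (\forall x \near x0, u x - phi x <= u x0 - phi x0) -> 0 <= Lop phi x0.

Definition viscosity_supersolution A u : Prop :=
  forall phi x0, C2 A phi -> A x0 ->
    (\forall x \near x0, u x0 - phi x0 <= u x - phi x) -> Lop phi x0 <= 0.

Definition viscosity_solution A u : Prop :=
  [/\ {within A, continuous u}, viscosity_subsolution A u
    & viscosity_supersolution A u].

End Viscosity.

(* Main.v *)
Require Import Defs.
From HB Require Import structures.
From mathcomp Require Import all_boot all_order all_algebra.
From mathcomp Require Import all_classical all_reals all_analysis.
From mathcomp Require Import ring lra.
Import Order.TTheory GRing.Theory Num.Theory.
Import numFieldNormedType.Exports.
Local Open Scope classical_set_scope.
Local Open Scope ring_scope.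

Set Implicit Arguments.
Unset Strict Implicit.
Unset Printing Implicit Defensive.

(* Put gamma = alpha + 1 and rho = d^(2 gamma) = |x'|^2 + x_n^(2 gamma)/gamma^2.
   For the unperturbed operator L_0 = x_n^(2 alpha) Lap_x' + D_nn one computes
     L_0 (x_n^k rho^p) = k (k - 1) x_n^(k - 2) rho^p
       + 2 p (2 p + n - 1 + (2 k - 1) / gamma) x_n^(k + 2 gamma - 2) rho^(p - 1).
   The second term vanishes for x_n d^(-Q) = x_n rho^(-Q/(2 gamma)), which is
   L_0-harmonic, and also for f = x_n^(1 + theta) rho^(-Q/(2 gamma) - theta/gamma),
   for which L_0 f = theta (1 + theta) x_n^(theta - 1) rho^(...) > 0. When
   theta < s the latter dominates the error due to L - L_0 for large rho, even
   near x_n = 0, so v = x_n d^(-Q) - f is a strict supersolution far out, and it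
   lies between x_n d^(-Q) / 2 and x_n d^(-Q). Integrating Du along vertical
   lines gives |u| <= 2 x_n for |x| >= 2 and u = o(x_n) at infinity. The solution
   is compared with C v + e x_n + h on {x_n >= h, r0 <= |x| <= M}; strictness
   forbids an interior contact point. Then h and e tend to 0. *)

(** * Directional derivatives and smooth functions on the half space *)

Section DirectionalDerivatives.
Context {R : realType} {V : normedModType R}.

(** A directional derivative sees only the restriction to a line, so one-variable rules become
    available without Fréchet differentiability. *)
Lemma is_derive_lineP (f : V -> R) (x v : V) (df : R) :
  is_derive x v f df <-> is_derive (0 : R) 1 (fun t : R => f (t *: v + x)) df.
Proof.
have E : 'D_v f x = 'D_1 (fun t : R => f (t *: v + x)) 0.
  rewrite /derive; set g1 := fun h => h^-1 *: _; set g2 := fun h => h^-1 *: _.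
  suff -> : g1 = g2 by [].
  apply/funext => h; rewrite /g1 /g2 /=.
  by rewrite addr0 scale0r add0r [_%:A]mulr1.
have [D1 D2] := derivable1P f x v.
by split=> -[D H]; (split; [by auto|]); [rewrite -E|rewrite E].
Qed.

End DirectionalDerivatives.

Section Lines.
Context {R : realType} {V : normedModType R}.

Lemma is_derive_line (f : V -> R) (x v : V) (t df : R) :
  is_derive (t *: v + x) v f df ->
  is_derive t 1 (fun t : R => f (t *: v + x)) df.
Proof.
move=> /is_derive_lineP H; apply/is_derive_lineP.
suff -> : (fun t0 : R => f ((t0 *: 1 + t) *: v + x)) =
          (fun t0 : R => f (t0 *: v + (t *: v + x))) by [].
by apply/funext => h; rewrite [_%:A]mulr1 scalerDl addrA.
Qed.

(** Restriction to the line through [x] in direction [v] reduces this to the one-variable chain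
    rule. *)
Lemma is_derive_comp (f : V -> R) (g : R -> R) (x v : V) (df dg : R) :
  is_derive x v f df -> is_derive (f x) 1 g dg ->
  is_derive x v (g \o f) (dg * df).
Proof.
move=> /is_derive_lineP Hf Hg; apply/is_derive_lineP.
have Hg' : is_derive (f (0 *: v + x)) 1 g dg by rewrite scale0r add0r.
exact: is_derive1_comp.
Qed.

End Lines.

(** * Functions with continuous iterated partial derivatives on the open half space *)

Section SmoothFunctions.
Context {R : realType} {m : nat}.
Implicit Types (f g : 'rV[R]_m.+1 -> R) (x v : 'rV[R]_m.+1).

Lemma is_derive_coord x v (i : 'I_m.+1) :
  is_derive x v (fun y : 'rV[R]_m.+1 => y 0 i) (v 0 i).
Proof.
apply/is_derive_lineP.
have -> : (fun t : R => (t *: v + x) 0 i) = ( *:%R (v 0 i) \o id) + cst (x 0 i).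
  by apply/funext => t; rewrite !mxE mulrC.
apply: is_derive_eq; by rewrite addr0 [_%:A]mulr1.
Qed.

Lemma open_half_space : open (half_space : set 'rV[R]_m.+1).
Proof.
have -> : (half_space : set 'rV[R]_m.+1) = xlast @^-1` [set r | 0 < r] by [].
by apply: open_comp; [move=> x _; exact: coord_continuous|exact: open_gt].
Qed.

(** Regularity is demanded only on the open half space, where real powers of [xlast] are smooth.
    Each partial derivative is supplied as an explicit function [g], so closure under sums, products
    and powers goes by induction on [n]. *)
Fixpoint smooth_upto (n : nat) f : Prop :=
  (forall x, half_space x -> {for x, continuous f}) /\
  if n is k.+1 then forall i, exists2 g, smooth_upto k g &
    forall x, half_space x -> is_derive x (evec i) f (g x)
  else True.

Lemma smooth_upto_continuous n f : smooth_upto n f ->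
  forall x, half_space x -> {for x, continuous f}.
Proof. by case: n => [|n] []. Qed.

Lemma smooth_uptoW n f : smooth_upto n.+1 f -> smooth_upto n f.
Proof.
elim: n f => [|n IH] f [cf df]; split => // i.
by have [g /IH Hg dg] := df i; exists g.
Qed.

Lemma smooth_upto_cst n (c : R) : smooth_upto n (cst c).
Proof.
elim: n c => [|n IH] c; split => //; try by move=> x _; exact: cst_continuous.
by move=> i; exists (cst 0) => // x _; exact: is_derive_cst.
Qed.

Lemma smooth_upto_coord n (i : 'I_m.+1) :
  smooth_upto n (fun x : 'rV[R]_m.+1 => x 0 i).
Proof.
case: n => [|n]; split => //; try by move=> x _; exact: coord_continuous.
move=> j; exists (cst (evec j 0 i)); first exact: smooth_upto_cst.
by move=> x _; exact: is_derive_coord.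
Qed.

Lemma smooth_uptoD n f g : smooth_upto n f -> smooth_upto n g ->
  smooth_upto n (f + g).
Proof.
elim: n f g => [|n IH] f g [cf df] [cg dg]; split => //.
- by move=> x Hx; apply: continuousD; [exact: cf|exact: cg].
- by move=> x Hx; apply: continuousD; [exact: cf|exact: cg].
move=> i; have [f' Hf' df'] := df i; have [g' Hg' dg'] := dg i.
exists (f' + g'); first exact: IH.
by move=> x Hx; apply: is_deriveD; [exact: df'|exact: dg'].
Qed.

Lemma smooth_uptoM n f g : smooth_upto n f -> smooth_upto n g ->
  smooth_upto n (f * g).
Proof.
elim: n f g => [|n IH] f g Hf Hg.
  split => // x Hx.
  by apply: continuousM; [exact: (smooth_upto_continuous Hf)|exact: (smooth_upto_continuous Hg)].
split.
  move=> x Hx.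
  by apply: continuousM; [exact: (smooth_upto_continuous Hf)|exact: (smooth_upto_continuous Hg)].
move=> i; have [_ /(_ i)[f' Hf' df']] := Hf; have [_ /(_ i)[g' Hg' dg']] := Hg.
exists (f * g' + g * f').
  by apply: smooth_uptoD; apply: IH => //; exact: smooth_uptoW.
by move=> x Hx; apply: is_derive_eq; [apply: is_deriveM; [exact: df'|exact: dg']|].
Qed.

Lemma derive_half_space f g i :
  (forall x, half_space x -> is_derive x (evec i) f (g x)) ->
  forall x, half_space x -> \forall y \near x, g y = 'D_(evec i) f y.
Proof.
move=> dfg x Hx; have := open_nbhs_nbhs (conj open_half_space Hx).
by apply: filterS => y Hy; have [_ ->] := dfg y Hy.
Qed.

Lemma continuous_at_derive f g i :
  (forall x, half_space x -> is_derive x (evec i) f (g x)) ->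
  (forall x, half_space x -> {for x, continuous g}) ->
  forall x, half_space x -> {for x, continuous ('D_(evec i) f)}.
Proof.
move=> dfg cg x Hx; have E := derive_half_space dfg Hx.
have : g @ x --> g x := cg x Hx.
rewrite (nbhs_singleton E); by apply: cvg_trans; exact: (@near_eq_cvg _ _ (nbhs x)).
Qed.

(** This makes the barriers admissible as viscosity test functions. *)
Lemma smooth_upto_C2 (A : set 'rV[R]_m.+1) f :
  A `<=` half_space -> smooth_upto 2 f -> C2 A f.
Proof.
move=> AH [cf df].
have sub (h : 'rV[R]_m.+1 -> R) : (forall x, half_space x -> {for x, continuous h}) ->
    {within A, continuous h}.
  move=> ch; have H : {in A, continuous h} by move=> x /set_mem /AH; exact: ch.
  exact: (continuous_in_subspaceT H).
split; first exact: sub.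
- move=> i; have [g [cg _] dg] := df i.
  split; last by apply: sub; exact: (continuous_at_derive dg).
  by move=> x /AH Hx; have [] := dg _ Hx.
- move=> i j; have [g [cg /(_ j)[h [ch _] dh]] dg] := df i.
  have dh' x : half_space x -> is_derive x (evec j) ('D_(evec i) f) (h x).
    move=> Hx; apply: near_eq_is_derive (dh _ Hx); exact: derive_half_space.
  split; last by apply: sub; exact: (continuous_at_derive dh').
  by move=> x /AH Hx; have [] := dh' _ Hx.
Qed.

(** The first derivative has to be known on the whole half space, since it is differentiated again;
    the second one is needed only at [x]. *)
Lemma pderiv2E f g h i j x : half_space x ->
  (forall y, half_space y -> is_derive y (evec i) f (g y)) ->
  is_derive x (evec j) g (h x) -> pderiv2 i j f x = h x.
Proof.
move=> Hx df dg; rewrite /pderiv2.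
by have [_ <-] := dg; apply/esym/near_eq_derive; exact: derive_half_space.
Qed.

End SmoothFunctions.

Section PositivePowers.
Context {R : realType}.

Lemma powR_pD (y k l : R) : 0 < y -> y `^ (k + l) = y `^ k * y `^ l.
Proof. by move=> y0; rewrite powRD// (gt_eqF y0) implybT. Qed.

Lemma powR_pB1 (y k : R) : 0 < y -> y `^ (k - 1) = y `^ k / y.
Proof. by move=> y0; rewrite powR_pD// powR_inv1// ltW. Qed.

End PositivePowers.

Section SmoothPower.
Context {R : realType} {m : nat}.

(** The induction on [n] keeps [k] general, because differentiation replaces [k] by [k - 1]. *)
Lemma smooth_upto_powR n (f : 'rV[R]_m.+1 -> R) (k : R) :
  smooth_upto n f -> (forall x, half_space x -> 0 < f x) ->
  smooth_upto n ((@powR R ^~ k) \o f).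
Proof.
move=> + f0; elim: n k => [|n IH] k sf.
  split=> [x Hx|]; last by [].
  apply: continuous_comp; first exact: sf.1.
  apply/differentiable_continuous/derivable1_diffP.
  by apply: ex_derive; apply: is_derive1_powR; exact: f0.
split.
  move=> x Hx; apply: continuous_comp; first exact: sf.1.
  apply/differentiable_continuous/derivable1_diffP.
  by apply: ex_derive; apply: is_derive1_powR; exact: f0.
move=> i; have [_ /(_ i)[f' sf' df']] := sf.
exists (cst k * ((@powR R ^~ (k - 1)) \o f) * f').
  apply: smooth_uptoM => //; apply: smooth_uptoM; first exact: smooth_upto_cst.
  by apply: IH; exact: smooth_uptoW.
move=> x Hx; apply: is_derive_comp; first exact: df'.
by apply: is_derive1_powR; exact: f0.
Qed.

End SmoothPower.

(** * The operator on monomials in x_n and rho *)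

Section OperatorLinearity.
Context {R : realType} {m : nat}.
Implicit Types (f g : 'rV[R]_m.+1 -> R) (x : 'rV[R]_m.+1).

Lemma pderiv2D f g i j x : smooth_upto 2 f -> smooth_upto 2 g ->
  half_space x -> pderiv2 i j (f \+ g) x = pderiv2 i j f x + pderiv2 i j g x.
Proof.
move=> [_ /(_ i)[f1 [_ /(_ j)[f2 _ Df2]] Df1]].
move=> [_ /(_ i)[g1 [_ /(_ j)[g2 _ Dg2]] Dg1]] Hx.
rewrite (pderiv2E Hx Df1 (Df2 _ Hx)) (pderiv2E Hx Dg1 (Dg2 _ Hx)).
apply: (@pderiv2E _ _ _ (f1 \+ g1) (f2 \+ g2) _ _ _ Hx).
  by move=> y Hy; apply: is_deriveD; [exact: Df1|exact: Dg1].
by apply: is_deriveD; [exact: Df2|exact: Dg2].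
Qed.

Lemma pderiv2Z c f i j x : smooth_upto 2 f ->
  half_space x -> pderiv2 i j (c \*: f) x = c * pderiv2 i j f x.
Proof.
move=> [_ /(_ i)[f1 [_ /(_ j)[f2 _ Df2]] Df1]] Hx.
rewrite (pderiv2E Hx Df1 (Df2 _ Hx)).
apply: (@pderiv2E _ _ _ (c \*: f1) (c \*: f2) _ _ _ Hx).
  by move=> y Hy; apply: is_deriveZ; exact: Df1.
by apply: is_deriveZ; exact: Df2.
Qed.

Lemma pderiv2_cst c i j x : half_space x ->
  pderiv2 i j (cst c : 'rV[R]_m.+1 -> R) x = 0.
Proof.
by move=> Hx; apply: (@pderiv2E _ _ _ (cst 0) (cst 0)).
Qed.

Lemma pderiv2_coord k i j x : half_space x ->
  pderiv2 i j (fun y : 'rV[R]_m.+1 => y 0 k) x = 0.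
Proof.
move=> Hx; apply: (@pderiv2E _ _ _ (cst (evec i 0 k)) (cst 0)) => //.
by move=> y _; exact: is_derive_coord.
Qed.

Variables (alpha : R) (a : 'I_m -> 'I_m -> 'rV[R]_m.+1 -> R)
  (b : 'I_m -> 'rV[R]_m.+1 -> R).

(** Viewing the operator as a linear form in an arbitrary array [P] of second derivatives separates
    its linearity, which is pure algebra, from the differentiation. *)
Definition second_order_form x (P : 'I_m.+1 -> 'I_m.+1 -> R) : R :=
  xlast x `^ (2 * alpha) *
    (\sum_(i < m) \sum_(j < m) a i j x * P (lift ord_max i) (lift ord_max j))
  + 2 * xlast x `^ alpha * (\sum_(i < m) b i x * P (lift ord_max i) ord_max)
  + P ord_max ord_max.

Lemma LopE f x :
  Lop alpha a b f x = second_order_form x (fun i j => pderiv2 i j f x).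
Proof. by []. Qed.

Lemma second_order_formD x P Q :
  second_order_form x (fun i j => P i j + Q i j) =
  second_order_form x P + second_order_form x Q.
Proof.
rewrite /second_order_form.
under eq_bigr do under eq_bigr do rewrite mulrDr.
under eq_bigr do rewrite big_split.
under [X in _ + _ * X + _]eq_bigr do rewrite mulrDr.
rewrite !big_split/=; ring.
Qed.

Lemma second_order_formZ x c P :
  second_order_form x (fun i j => c * P i j) = c * second_order_form x P.
Proof.
rewrite /second_order_form.
under eq_bigr do under eq_bigr do rewrite mulrCA.
under eq_bigr do rewrite -mulr_sumr.
under [X in _ + _ * X + _]eq_bigr do rewrite mulrCA.
rewrite -!mulr_sumr; ring.
Qed.

Lemma LopD f g x : smooth_upto 2 f -> smooth_upto 2 g -> half_space x ->
  Lop alpha a b (f \+ g) x = Lop alpha a b f x + Lop alpha a b g x.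
Proof.
move=> sf sg Hx; rewrite !LopE -second_order_formD; congr second_order_form.
by apply/funext => i; apply/funext => j; exact: (pderiv2D i j sf sg Hx).
Qed.

Lemma LopZ c f x : smooth_upto 2 f -> half_space x ->
  Lop alpha a b (c \*: f) x = c * Lop alpha a b f x.
Proof.
move=> sf Hx; rewrite !LopE -second_order_formZ; congr second_order_form.
by apply/funext => i; apply/funext => j; exact: (pderiv2Z c i j sf Hx).
Qed.

Lemma Lop_eq0 f x : (forall i j, pderiv2 i j f x = 0) -> Lop alpha a b f x = 0.
Proof.
move=> f0; rewrite LopE.
(* The zero array is written as [0 * 0] so that homogeneity applies with factor 0. *)
have -> : (fun i j => pderiv2 i j f x) = (fun i j => 0 * 0).
  by apply/funext => i; apply/funext => j; rewrite f0 mul0r.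
by rewrite second_order_formZ mul0r.
Qed.

End OperatorLinearity.

(** * Derivatives of the products of powers of x_n and rho *)

Section Monomials.
Context {R : realType} {m : nat}.
Implicit Types (x v : 'rV[R]_m.+1) (g k p : R).

Definition rho g x : R :=
  \sum_(i < m) x 0 (lift ord_max i) ^+ 2 + (g ^+ 2)^-1 * xlast x `^ (2 * g).

Definition monomial g k p x : R := xlast x `^ k * rho g x `^ p.

Lemma rho_gt0 g x : 0 < g -> half_space x -> 0 < rho g x.
Proof.
move=> g0 Hx; rewrite /rho ltr_wpDl ?sumr_ge0// => [i _|]; first exact: sqr_ge0.
by rewrite mulr_gt0 ?invr_gt0 ?exprn_gt0 ?powR_gt0.
Qed.

Lemma monomial_gt0 g k p x : 0 < g -> half_space x -> 0 < monomial g k p x.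
Proof. by move=> g0 Hx; rewrite mulr_gt0 ?powR_gt0 ?rho_gt0. Qed.

Lemma is_derive_xlast x v : is_derive x v xlast (xlast v).
Proof. exact: is_derive_coord. Qed.

Lemma is_derive_rho g x v : 0 < g -> half_space x ->
  is_derive x v (rho g)
    (2 * \sum_(i < m) x 0 (lift ord_max i) * v 0 (lift ord_max i) +
     2 / g * xlast x `^ (2 * g - 1) * xlast v).
Proof.
move=> g0 Hx.
have -> : rho g = \sum_(i < m) (fun y : 'rV[R]_m.+1 => y 0 (lift ord_max i)) ^+ 2
    + (g ^+ 2)^-1 \*: ((@powR R ^~ (2 * g)) \o xlast).
  by apply/funext => y; rewrite /rho !fctE/= fct_sumE.
apply: is_derive_eq.
  apply: is_deriveD.
    apply: is_derive_sum => i; apply: is_deriveX; exact: is_derive_coord.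
  apply: is_deriveZ; apply: is_derive_comp; first exact: is_derive_xlast.
  exact: is_derive1_powR.
congr (_ + _).
  rewrite mulr_sumr; apply: eq_bigr => i _.
  by rewrite /= expr1 mulrA.
rewrite -!/(_ * _) /GRing.scale/=; field.
by rewrite gt_eqF.
Qed.

Lemma is_derive_monomial g k p x v : 0 < g -> half_space x ->
  is_derive x v (monomial g k p)
    (k * xlast v * monomial g (k - 1) p x
     + p * (2 * \sum_(i < m) x 0 (lift ord_max i) * v 0 (lift ord_max i) +
     2 / g * xlast x `^ (2 * g - 1) * xlast v) * monomial g k (p - 1) x).
Proof.
move=> g0 Hx.
have -> : monomial g k p = ((@powR R ^~ k) \o xlast) * ((@powR R ^~ p) \o rho g) by [].
apply: is_derive_eq.
  apply: is_deriveM; apply: is_derive_comp.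
  - exact: is_derive_xlast.
  - exact: is_derive1_powR.
  - exact: is_derive_rho.
  - by apply: is_derive1_powR; exact: rho_gt0.
rewrite /GRing.scale/= /monomial; ring.
Qed.

Lemma is_derive_monomial_tan g k p x (i : 'I_m) : 0 < g -> half_space x ->
  is_derive x (evec (lift ord_max i)) (monomial g k p)
    (2 * p * x 0 (lift ord_max i) * monomial g k (p - 1) x).
Proof.
move=> g0 Hx; apply: is_derive_eq; first exact: is_derive_monomial.
rewrite /xlast /evec !mxE/= (negPf (neq_lift _ _)) !mulr0 mul0r add0r addr0.
rewrite (bigD1 i)//= big1 => [|j ji]; first by rewrite !mxE !eqxx/=; ring.
by rewrite mxE (inj_eq (@lift_inj _ _)) (negPf ji) andbF mulr0.
Qed.

(** Differentiating rho in x_n produces a power of x_n again, so the result is a combination of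
    monomials and the rule can be iterated. *)
Lemma is_derive_monomial_nor g k p x : 0 < g -> half_space x ->
  is_derive x (evec ord_max) (monomial g k p)
    (k * monomial g (k - 1) p x
     + 2 * p / g * monomial g (k + 2 * g - 1) (p - 1) x).
Proof.
move=> g0 Hx; apply: is_derive_eq; first exact: is_derive_monomial.
rewrite /xlast /evec !mxE/= !eqxx big1 => [|j _]; last first.
  by rewrite !mxE/= eq_sym (negPf (neq_lift _ _)) mulr0.
have y0 : 0 < xlast x := Hx; have r0 := rho_gt0 g0 Hx.
rewrite -/(xlast x) !mulr1n /monomial !(powR_pB1, powR_pD)//; field.
by rewrite !gt_eqF.
Qed.

Lemma smooth_upto_monomial n g k p : 0 < g ->
  smooth_upto n (monomial g k p : 'rV[R]_m.+1 -> R).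
Proof.
move=> g0; have sx : smooth_upto n (xlast : 'rV[R]_m.+1 -> R).
  exact: smooth_upto_coord.
apply: smooth_uptoM; first exact: (smooth_upto_powR k sx).
apply: (smooth_upto_powR p); last by move=> x; exact: rho_gt0.
have -> : rho g = \sum_(i < m) ((fun y : 'rV[R]_m.+1 => y 0 (lift ord_max i))
      * (fun y : 'rV[R]_m.+1 => y 0 (lift ord_max i)))
    + cst (g ^+ 2)^-1 * ((@powR R ^~ (2 * g)) \o xlast).
  by apply/funext => y; rewrite /rho !fctE/= fct_sumE.
apply: smooth_uptoD.
  elim/big_ind: _ => [|h1 h2 s1 s2|i _].
  - exact: smooth_upto_cst.
  - exact: smooth_uptoD.
  - by apply: smooth_uptoM; exact: smooth_upto_coord.
apply: smooth_uptoM; first exact: smooth_upto_cst.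
exact: (smooth_upto_powR _ sx).
Qed.

End Monomials.

(** * Exact action of L_0 on monomials, and the error due to L - L_0 *)

Section OperatorOnMonomials.
Context {R : realType} {m : nat}.
Implicit Types (x : 'rV[R]_m.+1) (g k p : R).

Lemma pderiv2_tan_tan g k p x (i j : 'I_m) : 0 < g -> half_space x ->
  pderiv2 (lift ord_max i) (lift ord_max j) (monomial g k p) x =
  2 * p * ((i == j)%:R * monomial g k (p - 1) x
    + 2 * (p - 1) * (x 0 (lift ord_max i) * x 0 (lift ord_max j))
      * monomial g k (p - 1 - 1) x).
Proof.
move=> g0 Hx.
apply: (@pderiv2E _ _ _
  ((2 * p) \*: ((fun y : 'rV[R]_m.+1 => y 0 (lift ord_max i)) *
              monomial g k (p - 1)))
  (fun x => 2 * p * ((i == j)%:R * monomial g k (p - 1) x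
    + 2 * (p - 1) * (x 0 (lift ord_max i) * x 0 (lift ord_max j))
      * monomial g k (p - 1 - 1) x)) _ _ _ Hx).
  move=> y Hy; apply: is_derive_eq; first exact: is_derive_monomial_tan.
  by rewrite /= /GRing.scale/= !mulrA.
apply: is_derive_eq.
  apply: is_deriveZ; apply: is_deriveM; first exact: is_derive_coord.
  exact: is_derive_monomial_tan.
rewrite /evec mxE eqxx/= (inj_eq (@lift_inj _ _)) /GRing.scale/=; ring.
Qed.

Lemma pderiv2_tan_nor g k p x (i : 'I_m) : 0 < g -> half_space x ->
  pderiv2 (lift ord_max i) ord_max (monomial g k p) x =
  2 * p * x 0 (lift ord_max i) * (k * monomial g (k - 1) (p - 1) x
    + 2 * (p - 1) / g * monomial g (k + 2 * g - 1) (p - 1 - 1) x).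
Proof.
move=> g0 Hx.
apply: (@pderiv2E _ _ _
  ((2 * p) \*: ((fun y : 'rV[R]_m.+1 => y 0 (lift ord_max i)) *
              monomial g k (p - 1)))
  (fun x => 2 * p * x 0 (lift ord_max i) * (k * monomial g (k - 1) (p - 1) x
    + 2 * (p - 1) / g * monomial g (k + 2 * g - 1) (p - 1 - 1) x)) _ _ _ Hx).
  move=> y Hy; apply: is_derive_eq; first exact: is_derive_monomial_tan.
  by rewrite /= /GRing.scale/= !mulrA.
apply: is_derive_eq.
  apply: is_deriveZ; apply: is_deriveM; first exact: is_derive_coord.
  exact: is_derive_monomial_nor.
rewrite /evec mxE eqxx/= eq_sym (negPf (neq_lift _ _)) /GRing.scale/=; ring.
Qed.

Lemma pderiv2_nor_nor g k p x : 0 < g -> half_space x ->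
  pderiv2 ord_max ord_max (monomial g k p) x =
  k * ((k - 1) * monomial g (k - 1 - 1) p x
    + 2 * p / g * monomial g (k - 1 + 2 * g - 1) (p - 1) x)
  + 2 * p / g * ((k + 2 * g - 1) * monomial g (k + 2 * g - 1 - 1) (p - 1) x
    + 2 * (p - 1) / g
      * monomial g (k + 2 * g - 1 + 2 * g - 1) (p - 1 - 1) x).
Proof.
move=> g0 Hx.
apply: (@pderiv2E _ _ _
  (k \*: monomial g (k - 1) p
    + (2 * p / g) \*: monomial g (k + 2 * g - 1) (p - 1))
  (fun x => k * ((k - 1) * monomial g (k - 1 - 1) p x
    + 2 * p / g * monomial g (k - 1 + 2 * g - 1) (p - 1) x)
  + 2 * p / g * ((k + 2 * g - 1) * monomial g (k + 2 * g - 1 - 1) (p - 1) x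
    + 2 * (p - 1) / g
      * monomial g (k + 2 * g - 1 + 2 * g - 1) (p - 1 - 1) x)) _ _ _ Hx).
  by move=> y Hy; apply: is_derive_monomial_nor.
by apply: is_derive_eq;
  [apply: is_deriveD; apply: is_deriveZ; exact: is_derive_monomial_nor|].
Qed.

Lemma Grushin_monomial g k p x : 0 < g -> half_space x ->
  xlast x `^ (2 * (g - 1)) *
    (\sum_(i < m) pderiv2 (lift ord_max i) (lift ord_max i) (monomial g k p) x)
  + pderiv2 ord_max ord_max (monomial g k p) x =
  k * (k - 1) * monomial g (k - 1 - 1) p x
  + 2 * p * (2 * p + m%:R + (2 * k - 1) / g)
    * monomial g (k + 2 * g - 1 - 1) (p - 1) x.
Proof.
move=> g0 Hx; rewrite pderiv2_nor_nor//.
under eq_bigr do rewrite pderiv2_tan_tan// eqxx mul1r -expr2.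
rewrite -mulr_sumr big_split/= sumr_const card_ord -mulr_suml -mulr_sumr.
rewrite -[_ *+ m]mulr_natl.
have r0 := rho_gt0 g0 Hx.
have : rho g x = \sum_(i < m) x 0 (lift ord_max i) ^+ 2
  + (g ^+ 2)^-1 * xlast x `^ (2 * g) by [].
rewrite /monomial; move: r0; move: (rho g x) => r r0.
move: (\sum_(i < m) _) => S rE.
have y0 : 0 < xlast x := Hx.
have -> : 2 * (g - 1) = 2 * g - 1 - 1 by ring.
rewrite !(powR_pB1, powR_pD)//.
(* Solving the definition of rho for x_n^(2g) leaves [r] and [S] as independent variables, after
   which the claim is a rational identity. *)
have <- : (g ^+ 2) * (r - S) = xlast x `^ (2 * g).
  by rewrite rE; field; rewrite gt_eqF.
field.
by rewrite !gt_eqF.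
Qed.

Lemma coord_sqr_le_rho g x (i : 'I_m) : 0 < g -> x 0 (lift ord_max i) ^+ 2 <= rho g x.
Proof.
move=> g0; rewrite /rho (bigD1 i)//= -addrA lerDl addr_ge0//.
  by apply: sumr_ge0 => j _; exact: sqr_ge0.
by rewrite mulr_ge0 ?powR_ge0// invr_ge0 sqr_ge0.
Qed.

Lemma xlast_pow_le_rho g x : 0 < g -> xlast x `^ (2 * g) <= g ^+ 2 * rho g x.
Proof.
move=> g0; rewrite /rho mulrDr mulVKf ?gt_eqF ?exprn_gt0// lerDr.
by rewrite mulr_ge0 ?sqr_ge0// sumr_ge0// => i _; exact: sqr_ge0.
Qed.

(** This ratio is invariant under the dilations for which x_n has degree 1 and rho degree [2 * g].
    It is bounded by [g] and tends to 0 at points of the boundary x_n = 0 with x' nonzero. *)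
Definition slope g x : R := xlast x `^ g * rho g x `^ (- 2^-1).

Lemma slope_gt0 g x : 0 < g -> half_space x -> 0 < slope g x.
Proof. by move=> g0 Hx; rewrite mulr_gt0 ?powR_gt0 ?rho_gt0. Qed.

Lemma slope_le g x : 0 < g -> half_space x -> slope g x <= g.
Proof.
move=> g0 Hx; have r0 := rho_gt0 g0 Hx.
rewrite /slope powRN ler_pdivrMr ?powR_gt0// -ler_sqr ?nnegrE; first last.
- by rewrite mulr_ge0 ?powR_ge0// ltW.
- exact: powR_ge0.
rewrite exprMn powR12_sqrt ?(ltW r0)// sqr_sqrtr ?(ltW r0)//.
have := xlast_pow_le_rho x g0.
by rewrite [2 * g]mulrC powRrM powR_mulrn// powR_ge0.
Qed.

(** The first summand collects the [m ^ 2] tangential entries, with one [g] from bounding one of two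
    factors [slope]; the second collects the mixed entries, whose 4 combines the 2 in the operator
    with the 2 in the derivative bound. *)
Definition perturbation_const g k p : R :=
  m%:R ^+ 2 * (2 * `|p| * (1 + 2 * `|p - 1|)) * g
  + 4 * m%:R * (`|p| * (`|k| + 2 * `|p - 1| * g)).

(** Since x_i^2 and x_j^2 are at most rho, so is |x_i x_j|, which absorbs the extra negative power
    of rho. *)
Lemma pderiv2_tan_tan_le g k p x (i j : 'I_m) : 0 < g -> half_space x ->
  `|pderiv2 (lift ord_max i) (lift ord_max j) (monomial g k p) x|
    <= 2 * `|p| * (1 + 2 * `|p - 1|) * monomial g k (p - 1) x.
Proof.
move=> g0 Hx; have r0 := rho_gt0 g0 Hx.
have M12 : monomial g k (p - 1) x = rho g x * monomial g k (p - 1 - 1) x.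
  by rewrite /monomial (powR_pB1 (p - 1) r0); field; rewrite gt_eqF.
have := monomial_gt0 k (p - 1) g0 Hx; have := monomial_gt0 k (p - 1 - 1) g0 Hx.
rewrite pderiv2_tan_tan//; move: M12.
move: (monomial g k (p - 1) x) (monomial g k (p - 1 - 1) x) => M1 M2 M12 M20 M10.
rewrite !normrM normr_nat -!mulrA ler_wpM2l// ler_wpM2l//.
rewrite [leRHS]mulrDl mul1r (le_trans (ler_normD _ _))// lerD//.
  by rewrite normrM normr_nat (gtr0_norm M10) ler_piMl ?lern1 ?leq_b1// ltW.
rewrite !normrM normr_nat (gtr0_norm M20) -!mulrA ler_wpM2l// ler_wpM2l//.
rewrite mulrA -normrM M12 ler_wpM2r ?(ltW M20)// ler_norml.
have := coord_sqr_le_rho x i g0; have := coord_sqr_le_rho x j g0.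
move: (x _ _) (x _ _) => xi xj hi hj.
have := sqr_ge0 (xi - xj); have := sqr_ge0 (xi + xj).
rewrite !expr2 in hi hj * => h1 h2; apply/andP; split; nra.
Qed.

(** The factor |x_i| costs half a power of rho, and x_n^(2g) is at most g^2 rho. *)
Lemma pderiv2_tan_nor_le g k p x (i : 'I_m) : 0 < g -> half_space x ->
  `|pderiv2 (lift ord_max i) ord_max (monomial g k p) x|
    <= 2 * `|p| * (`|k| + 2 * `|p - 1| * g)
       * monomial g (k - 1) (p - 2^-1) x.
Proof.
move=> g0 Hx; have r0 := rho_gt0 g0 Hx; have y0 : 0 < xlast x := Hx.
have M12 : monomial g (k - 1) (p - 2^-1) x =
    rho g x `^ 2^-1 * monomial g (k - 1) (p - 1) x.
  rewrite /monomial mulrCA -powR_pD//; congr (_ * _ `^ _); lra.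
have M31 : monomial g (k + 2 * g - 1) (p - 1 - 1) x =
    xlast x `^ (2 * g) / rho g x * monomial g (k - 1) (p - 1) x.
  rewrite /monomial !(powR_pB1, powR_pD)//; field.
  by rewrite !gt_eqF.
have := monomial_gt0 (k - 1) (p - 1) g0 Hx; move: M12 M31.
rewrite pderiv2_tan_nor//.
move: (monomial g (k - 1) (p - 2^-1) x) (monomial g (k - 1) (p - 1) x)
  (monomial g (k + 2 * g - 1) (p - 1 - 1) x) => M2 M1 M3 -> -> M10.
rewrite !normrM normr_nat -!mulrA ler_wpM2l// ler_wpM2l//.
rewrite [leRHS]mulrCA ler_pM//.
  have := coord_sqr_le_rho x i g0.
  rewrite powR12_sqrt ?(ltW r0)// => h; rewrite -sqrtr_sqr; exact: ler_wsqrtr.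
rewrite (le_trans (ler_normD _ _))// [leRHS]mulrDl lerD//.
  by rewrite normrM (gtr0_norm M10).
rewrite !normrM normr_nat !normfV (gtr0_norm g0) (gtr0_norm M10) (gtr0_norm r0).
rewrite -!mulrA ler_wpM2l// ler_wpM2l// !mulrA ler_wpM2r ?(ltW M10)//.
rewrite ler_pdivrMr// mulrC ler_pdivrMr// mulrAC -expr2.
by rewrite (ger0_norm (powR_ge0 _ _)) xlast_pow_le_rho.
Qed.

(** Measured against x_n^(k-2) rho^p, the weighted tangential derivatives carry [slope] squared and
    the mixed ones carry [slope]. The error therefore retains at least one factor [slope], which is
    the gain needed near x_n = 0. *)
Lemma Lop_monomial_perturbation (alpha k p eps : R)
    (a : 'I_m -> 'I_m -> 'rV[R]_m.+1 -> R) (b : 'I_m -> 'rV[R]_m.+1 -> R) x :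
  let g := alpha + 1 in 0 < g -> half_space x -> 0 <= eps ->
  (forall i j, `|a i j x - (i == j)%:R| + `|b i x| <= eps) ->
  `|Lop alpha a b (monomial g k p) x -
   (k * (k - 1) * monomial g (k - 1 - 1) p x
  + 2 * p * (2 * p + m%:R + (2 * k - 1) / g)
    * monomial g (k + 2 * g - 1 - 1) (p - 1) x)|
  <= eps * perturbation_const g k p * slope g x * monomial g (k - 1 - 1) p x.
Proof.
move=> g g0 Hx eps0 ab_eps; have y0 : 0 < xlast x := Hx.
have r0 := rho_gt0 g0 Hx.
rewrite -Grushin_monomial// /Lop.
set S := \sum_(i < m) _; set T := \sum_(i < m) _; set U := \sum_(i < m) _.
have -> : 2 * (g - 1) = 2 * alpha by rewrite /g; ring.
have SE : S - U = \sum_(i < m) \sum_(j < m) (a i j x - (i == j)%:R)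
   * pderiv2 (lift ord_max i) (lift ord_max j) (monomial g k p) x.
  rewrite -sumrB; apply: eq_bigr => i _.
  under [RHS]eq_bigr do rewrite mulrBl.
  have -> : pderiv2 (lift ord_max i) (lift ord_max i) (monomial g k p) x =
      \sum_(j < m) (i == j)%:R
        * pderiv2 (lift ord_max i) (lift ord_max j) (monomial g k p) x.
    rewrite (bigD1 i)//= eqxx mul1r big1 ?addr0// => j ji.
    by rewrite eq_sym (negPf ji) mul0r.
  by rewrite sumrB.
have mP (F : 'I_m -> R) (c : R) : (forall i, `|F i| <= c) ->
    `|\sum_(i < m) F i| <= m%:R * c.
  move=> Fc; rewrite (le_trans (ler_norm_sum _ _ _))//.
  rewrite (le_trans (ler_sum _ (fun i _ => Fc i)))//.
  by rewrite sumr_const card_ord -[c *+ m]mulr_natl.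
have SU : `|S - U| <= m%:R * (m%:R * (eps *
    (2 * `|p| * (1 + 2 * `|p - 1|) * monomial g k (p - 1) x))).
  rewrite SE; apply: (mP) => i; apply: (mP) => j; rewrite normrM ler_pM//; last first.
    exact: pderiv2_tan_tan_le.
  by apply: le_trans (ab_eps i j); rewrite lerDl.
have TB : `|T| <= m%:R * (eps * (2 * `|p| * (`|k| + 2 * `|p - 1| * g)
       * monomial g (k - 1) (p - 2^-1) x)).
  apply: (mP) => i; rewrite normrM ler_pM//.
    by apply: le_trans (ab_eps i i); rewrite lerDr.
  exact: pderiv2_tan_nor_le.
have -> : xlast x `^ (2 * alpha) * S + 2 * xlast x `^ alpha * T
   + pderiv2 ord_max ord_max (monomial g k p) x
   - (xlast x `^ (2 * alpha) * U + pderiv2 ord_max ord_max (monomial g k p) x)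
   = xlast x `^ (2 * alpha) * (S - U) + 2 * xlast x `^ alpha * T by ring.
rewrite (le_trans (ler_normD _ _))// !normrM normr_nat !(ger0_norm (powR_ge0 _ _)).
have M1 : xlast x `^ (2 * alpha) * monomial g k (p - 1) x =
   slope g x ^+ 2 * monomial g (k - 1 - 1) p x.
  rewrite /slope exprMn -!powR_mulrn ?powR_ge0// -!powRrM.
  rewrite mulNr mulVf ?pnatr_eq0// powR_inv1 ?ltW//.
  have -> : 2 * alpha = g * 2 - 1 - 1 by rewrite /g; ring.
  rewrite /monomial !powR_pB1//; field.
  by rewrite !gt_eqF.
have M2 : xlast x `^ alpha * monomial g (k - 1) (p - 2^-1) x =
   slope g x * monomial g (k - 1 - 1) p x.
  rewrite /slope.
  have -> : alpha = g - 1 by rewrite /g; ring.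
  rewrite /monomial !(powR_pB1, powR_pD)//; field.
  by rewrite !gt_eqF.
apply: le_trans (lerD (ler_wpM2l (powR_ge0 _ _) SU)
  (ler_wpM2l (mulr_ge0 _ (powR_ge0 _ _)) TB)) _ => //.
have -> : xlast x `^ (2 * alpha) * (m%:R * (m%:R * (eps *
    (2 * `|p| * (1 + 2 * `|p - 1|) * monomial g k (p - 1) x)))) =
  m%:R ^+ 2 * eps * (2 * `|p| * (1 + 2 * `|p - 1|))
    * (xlast x `^ (2 * alpha) * monomial g k (p - 1) x) by ring.
have -> : 2 * xlast x `^ alpha * (m%:R * (eps *
    (2 * `|p| * (`|k| + 2 * `|p - 1| * g)
       * monomial g (k - 1) (p - 2^-1) x))) =
  4 * m%:R * eps * (`|p| * (`|k| + 2 * `|p - 1| * g))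
    * (xlast x `^ alpha * monomial g (k - 1) (p - 2^-1) x) by ring.
rewrite M1 M2 /perturbation_const.
have := monomial_gt0 (k - 1 - 1) p g0 Hx; have := slope_gt0 g0 Hx.
have := slope_le g0 Hx.
move: (monomial _ _ _ _) (slope _ _) => M z zg z0 M0.
(* The quadratic term in [slope] is reduced to a linear one by [slope <= g]. *)
have e0 : 0 <= eps * z * M * (m%:R ^+ 2 * (2 * `|p| * (1 + 2 * `|p - 1|))).
  by rewrite !mulr_ge0// ltW.
rewrite -subr_ge0; have zg0 : 0 <= g - z by rewrite subr_ge0.
by apply: (eq_ind _ (Order.le 0) (mulr_ge0 e0 zg0)); ring.
Qed.

End OperatorOnMonomials.

(** * The barrier *)

Section Barrier.
Context {R : realType} {m : nat}.
Implicit Types (x : 'rV[R]_m.+1).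

Lemma powRN_eventually_lt (tau C e : R) : 0 < tau -> 0 < e ->
  exists2 r0 : R, 1 <= r0 & forall r, r0 <= r -> r `^ (- tau) * C < e.
Proof.
move=> tau0 e0; have Ce : 0 <= `|C| / e by rewrite divr_ge0// ltW.
have C1 : 0 < 1 + `|C| / e by rewrite ltr_pwDl.
(* The summand 1 puts the threshold above 1 and makes the final inequality strict. *)
exists ((1 + `|C| / e) `^ tau^-1).
  rewrite -[leLHS](powRr0 (1 + `|C| / e)) ler_powR ?lerDl// invr_ge0 ltW//.
move=> r r0r; have r0 : 0 < r by apply: lt_le_trans r0r; rewrite powR_gt0.
have : (1 + `|C| / e) `^ tau^-1 `^ tau <= r `^ tau.
  by rewrite ge0_ler_powR ?nnegrE ?powR_ge0 ?(ltW tau0) ?(ltW r0).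
rewrite -powRrM mulVf ?gt_eqF// powRr1 ?(ltW C1)// => Cr.
rewrite powRN mulrC ltr_pdivrMr ?powR_gt0//.
apply: le_lt_trans (ler_norm _) _; rewrite mulrC -ltr_pdivrMr//.
by apply: lt_le_trans Cr; rewrite ltrDr.
Qed.

Lemma gaugeE (alpha : R) x :
  gauge alpha x = rho (alpha + 1) x `^ (2 * (alpha + 1))^-1.
Proof.
rewrite /gauge /rho /enorm sqr_sqrtr; last first.
  by apply: sumr_ge0 => i _; exact: sqr_ge0.
by congr ((_ + _) `^ _); apply: eq_bigr => i _; rewrite mxE.
Qed.

(** Both monomials have exponents that annihilate the second term of L_0, so only theta (1 + theta)
    x_n^(theta-1) rho^(-q) survives, and it beats both perturbation errors for large rho. The
    condition [theta < s] gives the decay, and [theta <= alpha + 1] controls [slope] near x_n = 0.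
    The threshold is fixed before the coefficients. *)
Lemma barrier_inequalities (alpha s theta : R) :
  0 < alpha -> 0 < theta -> theta < s -> theta <= alpha + 1 ->
  let g := alpha + 1 in
  let p := hom_dim m alpha / (2 * g) in
  exists2 r0 : R, 1 <= r0 & forall x, half_space x -> r0 <= rho g x ->
    monomial g (1 + theta) (- (p + theta / g)) x <= monomial g 1 (- p) x / 2 /\
  forall (a : 'I_m -> 'I_m -> 'rV[R]_m.+1 -> R) (b : 'I_m -> 'rV[R]_m.+1 -> R),
  (forall i j, `|a i j x - (i == j)%:R| + `|b i x| <= gauge alpha x `^ (- s)) ->
    Lop alpha a b (monomial g 1 (- p)) x <
    Lop alpha a b (monomial g (1 + theta) (- (p + theta / g))) x.
Proof.
move=> a0 t0 ts tg g p.
have g1 : 1 <= g by rewrite lerDr ltW.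
have g0 : 0 < g := lt_le_trans ltr01 g1.
set q := p + theta / g.
pose E1 := @perturbation_const R m g 1 (- p).
pose E2 := @perturbation_const R m g (1 + theta) (- q).
have E10 : 0 <= E1.
  by rewrite /E1 /perturbation_const addr_ge0// !(mulr_ge0, addr_ge0)// ltW.
have E20 : 0 <= E2.
  by rewrite /E2 /perturbation_const addr_ge0// !(mulr_ge0, addr_ge0)// ltW.
(* Net decay rate in rho: [s] from the coefficients, less [theta] lost in comparing the two
   monomials. *)
pose tau := (s - theta) / (2 * g).
have tau0 : 0 < tau by rewrite divr_gt0 ?subr_gt0 ?mulr_gt0.
have tg0 : 0 < theta / (2 * g) by rewrite divr_gt0 ?mulr_gt0.
have tt0 : 0 < theta * (1 + theta) by rewrite mulr_gt0 ?addr_gt0.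
have [r1 r11 Hr1] := powRN_eventually_lt (g * (E1 + E2)) tau0 tt0.
have h0 : (0 : R) < 2^-1 by rewrite invr_gt0.
have [r2 r21 Hr2] := powRN_eventually_lt g tg0 h0.
exists (Num.max r1 r2); first by rewrite le_max r11.
move=> x Hx; rewrite ge_max => /andP[/[dup] r1x /Hr1 {}Hr1 /Hr2 {}Hr2].
have rx1 : 1 <= rho g x := le_trans r11 r1x.
have r0 := rho_gt0 g0 Hx; have y0 : 0 < xlast x := Hx.
have Z0 := slope_gt0 g0 Hx; have Zg := slope_le g0 Hx.
(* [W] equals x_n^theta rho^(-theta/(2g)), the scale-invariant part of the quotient of the two
   monomials. *)
pose W := slope g x `^ (theta / g).
have tg1 : 0 <= theta / g <= 1
  by rewrite divr_ge0 ?(ltW t0) ?(ltW g0)//= ler_pdivrMr// mul1r.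
have WE : W = xlast x `^ theta * rho g x `^ (- (theta / (2 * g))).
  rewrite /W /slope powRM ?powR_ge0// -!powRrM; congr (_ `^ _ * _ `^ _).
    by field; rewrite gt_eqF.
  by field; rewrite gt_eqF.
have Wg : W <= g.
  rewrite /W; apply: (@le_trans _ _ (g `^ (theta / g))).
    by rewrite ge0_ler_powR ?nnegrE ?(ltW Z0) ?(ltW g0)//; case/andP: tg1.
  by apply: ler1_powR => //; case/andP: tg1.
(* As the exponent theta/g is at most 1 and [slope] is bounded, [slope] is controlled by [W]; this
   trades the [slope] in the error for the factor x_n^theta. *)
have ZW : slope g x <= g * W.
  have -> : slope g x = slope g x `^ (1 - theta / g) * W.
    by rewrite /W -powR_pD// subrK powRr1// ltW.
  rewrite ler_wpM2r ?powR_ge0//; apply: (@le_trans _ _ (g `^ (1 - theta / g))).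
    by rewrite ge0_ler_powR ?nnegrE ?(ltW Z0) ?(ltW g0)// ?subr_ge0; case/andP: tg1.
  by apply: ler1_powR => //; rewrite gerBl; case/andP: tg1.
have F2E : monomial g (1 + theta) (- q) x =
    monomial g 1 (- p) x * (W * rho g x `^ (- (theta / (2 * g)))).
  rewrite WE /monomial /q mulrACA; rewrite -!mulrA -!powR_pD// mulrA -powR_pD//.
  by congr (_ * _ `^ _); field; rewrite gt_eqF.
split.
  rewrite F2E ler_wpM2l ?(ltW (monomial_gt0 _ _ _ _))//.
  apply: le_trans (ltW Hr2); rewrite mulrC ler_wpM2l ?powR_ge0//.
move=> a b; have -> : gauge alpha x `^ (- s) = rho g x `^ (- (s / (2 * g))).
  by rewrite gaugeE -/g -powRrM; congr (_ `^ _); field; rewrite gt_eqF.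
set eps := rho g x `^ (- (s / (2 * g))) => ab; have eps0 : 0 <= eps by exact: powR_ge0.
have c1 : 2 * - p + m%:R + (2 * 1 - 1) / g = 0.
  by rewrite /p /hom_dim -/g; field; rewrite gt_eqF.
have c2 : 2 * - q + m%:R + (2 * (1 + theta) - 1) / g = 0.
  by rewrite /q /p /hom_dim -/g; field; rewrite gt_eqF.
have := Lop_monomial_perturbation 1 (- p) g0 Hx eps0 ab.
have := Lop_monomial_perturbation (1 + theta) (- q) g0 Hx eps0 ab.
rewrite -/g -/E1 -/E2 c1 c2.
have := monomial_gt0 (1 - 1 - 1) (- p) g0 Hx.
have := monomial_gt0 (1 + theta - 1 - 1) (- q) g0 Hx.
have AN : W * monomial g (1 - 1 - 1) (- p) x =
    monomial g (1 + theta - 1 - 1) (- q) x * rho g x `^ (theta / (2 * g)).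
  rewrite WE /monomial mulrACA -[RHS]mulrA -!powR_pD//.
  by congr (_ `^ _ * _ `^ _); [ring|rewrite /q; field; rewrite ?gt_eqF].
move: AN; move: (monomial g (1 - 1 - 1) (- p) x) (monomial g (1 + theta - 1 - 1) (- q) x).
move: (Lop _ _ _ _ _) (Lop _ _ _ _ _) => L1 L2 A N AN N0 A0.
move: (monomial _ _ _ _) (monomial _ _ _ _) => M2 M1.
have -> : L2 - ((1 + theta) * (1 + theta - 1) * N + 2 * - q * 0 * M1)
  = L2 - theta * (1 + theta) * N by ring.
have -> : L1 - (1 * (1 - 1) * A + 2 * - p * 0 * M2) = L1 by ring.
rewrite !ler_norml => /andP[H2 _] /andP[_ H1].
set T := rho g x `^ (- tau) in Hr1.
have TE : T = eps * rho g x `^ (theta / (2 * g)).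
  by rewrite -powR_pD//; congr (_ `^ _); rewrite /tau; field; rewrite gt_eqF.
have epsT : eps <= T.
  rewrite TE ler_peMr// -[leLHS](powRr0 (rho g x)); apply: ler_powR => //.
  exact: ltW.
have T0 : 0 <= T by exact: powR_ge0.
(* The error of the first monomial is converted into a multiple of [N], the scale of the positive
   term, through [ZW] and [AN]. *)
have B1 : eps * E1 * slope g x * A <= T * E1 * g * N.
  apply: (@le_trans _ _ (eps * E1 * (g * W) * A)).
    by rewrite ler_wpM2r ?(ltW A0)// ler_wpM2l// mulr_ge0.
  by rewrite -!mulrA AN TE le_eqVlt; apply/orP; left; apply/eqP; ring.
have B2 : eps * E2 * slope g x * N <= T * E2 * g * N.
  rewrite ler_wpM2r ?(ltW N0)//; apply: ler_pM => //; [exact: mulr_ge0|exact: ltW|].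
  exact: ler_wpM2r.
apply: le_lt_trans (le_trans H1 B1) _.
have : 0 < (theta * (1 + theta) - T * (g * (E1 + E2))) * N.
  by rewrite mulr_gt0// subr_gt0.
move: H2 B2; lra.
Qed.

End Barrier.

(** * Comparison and growth *)

Section HalfSpaceGeometry.
Context {R : realType} {m : nat}.
Implicit Types (x z : 'rV[R]_m.+1) (w B u : 'rV[R]_m.+1 -> R).

Lemma enorm_continuous k : continuous (@enorm R k).
Proof.
move=> x; rewrite /enorm.
apply: (@continuous_comp _ _ _ (fun y : 'rV[R]_k => \sum_(i < k) y 0 i ^+ 2)
  (@Num.sqrt R)); last exact: sqrt_continuous.
have -> : (fun y : 'rV[R]_k => \sum_(i < k) y 0 i ^+ 2) =
    \sum_(i < k) (fun y : 'rV[R]_k => y 0 i) ^+ 2.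
  by apply/funext => y; rewrite fct_sumE.
elim/big_ind: _ => [|f h cf ch|i _].
- exact: cst_continuous.
- exact: continuousD.
- have ci : {for x, continuous (fun y : 'rV[R]_k => y 0 i)}.
    exact: coord_continuous.
  exact: (continuousM ci ci).
Qed.

Lemma xlast_continuous : continuous (@xlast R m).
Proof. by move=> x; exact: coord_continuous. Qed.

Lemma sqr_enorm k (x : 'rV[R]_k) : enorm x ^+ 2 = \sum_(i < k) x 0 i ^+ 2.
Proof. by rewrite sqr_sqrtr// sumr_ge0// => i _; exact: sqr_ge0. Qed.

Lemma enorm_ge0 k (x : 'rV[R]_k) : 0 <= enorm x.
Proof. exact: sqrtr_ge0. Qed.

Lemma coord_le_enorm k (x : 'rV[R]_k) i : `|x 0 i| <= enorm x.
Proof.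
rewrite -sqrtr_sqr ler_wsqrtr// (bigD1 i)//= lerDl.
by apply: sumr_ge0 => j _; exact: sqr_ge0.
Qed.

Lemma sqr_enorm_split x :
  enorm x ^+ 2 = \sum_(i < m) x 0 (lift ord_max i) ^+ 2 + xlast x ^+ 2.
Proof.
rewrite sqr_enorm big_ord_recr/=; congr (_ + _); apply: eq_bigr => i _.
by congr (x 0 _ ^+ 2); apply: val_inj; rewrite [RHS]lift_max.
Qed.

Lemma compact_half_shell (h r M : R) :
  compact [set x : 'rV[R]_m.+1 | h <= xlast x /\ r <= enorm x <= M].
Proof.
have cbox : compact
    [set v : 'rV[R]_m.+1 | forall i, v ord0 i \in `[- M, M]].
  apply: (@rV_compact _ _ (fun=> `[- M, M]%classic)) => _.
  exact: segment_compact.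
apply: (subclosed_compact _ cbox).
  have -> : [set x : 'rV[R]_m.+1 | h <= xlast x /\ r <= enorm x <= M] =
      (@xlast R m @^-1` [set y | h <= y]) `&`
      ((@enorm R m.+1 @^-1` [set y | r <= y]) `&`
      (@enorm R m.+1 @^-1` [set y | y <= M])).
    by apply/seteqP; split=> x /= [? /andP].
  apply: closedI; first apply: preimage_closed; last apply: closedI.
  - by move=> x _; exact: xlast_continuous.
  - exact: closed_ge.
  - by apply: preimage_closed; [move=> x _; exact: enorm_continuous|exact: closed_ge].
  - by apply: preimage_closed; [move=> x _; exact: enorm_continuous|exact: closed_le].
move=> x [_ /andP[_ xM]] i; rewrite in_itv/= -ler_norml.
exact: le_trans (coord_le_enorm _ _) xM.
Qed.

Lemma outside_ball_ext_domain x :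
  half_space x -> 1 < enorm x -> ext_domain x.
Proof.
move=> Hx x1; split => // cx.
have : closure [set x : 'rV[R]_m.+1 | enorm x <= 1] x.
  by apply: closure_subset cx => y [/ltW].
rewrite -(closure_id _).1 => [|]; first by rewrite /= leNgt x1.
apply: (@preimage_closed _ _ (@enorm R m.+1) [set y | y <= 1]).
  by move=> y _; exact: enorm_continuous.
exact: closed_le.
Qed.

Lemma ext_closed_interior x :
  half_space x -> 1 < enorm x -> (@ext_closed R m 1)° x.
Proof.
move=> Hx x1; have n1 : \forall y \near x, half_space y.
  exact: open_nbhs_nbhs (conj open_half_space Hx).
have n2 : \forall y \near x, 1 < enorm y.
  exact: (cvgr_gt _ (@enorm_continuous _ x) _ x1).
by apply: filterS2 n1 n2 => y Hy /ltW y1; split=> //; exact: ltW.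
Qed.

(** A positive maximum of [w - B] over the compact shell cannot lie on its boundary, so it is an
    unrestricted local maximum, which is excluded. Cutting at height [h > 0] keeps the shell inside
    the open domain. *)
Lemma half_shell_comparison w B (h r M : R) : 0 < h -> 1 < r ->
  {within ext_domain, continuous w} ->
  (forall x, half_space x -> {for x, continuous B}) ->
  (forall x, h <= xlast x -> r <= enorm x <= M ->
     [\/ xlast x = h, enorm x = r | enorm x = M] -> w x <= B x) ->
  (forall x, h < xlast x -> r < enorm x ->
     ~ (\forall y \near x, w y - B y <= w x - B x)) ->
  forall x, h <= xlast x -> r <= enorm x <= M -> w x <= B x.
Proof.
move=> h0 r1 cw cB bnd noloc x hx rx.
pose K := [set x : 'rV[R]_m.+1 | h <= xlast x /\ r <= enorm x <= M].
have Kx : K x by [].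
have KD : K `<=` ext_domain.
  move=> y [hy /andP[ry _]]; apply: outside_ball_ext_domain.
    exact: lt_le_trans h0 hy.
  exact: lt_le_trans r1 ry.
have cwB : {within K, continuous (w \- B)}.
  apply/subspace_continuousP => y Ky; apply: cvgB.
    by move/(continuous_subspaceW KD)/subspace_continuousP: cw; exact.
  by apply: cvg_within_filter; apply: cB; have [[]] := KD _ Ky.
have [|c /set_mem Kc maxc] := EVT_max_rV (ex_intro _ x Kx) _ cwB.
  exact: compact_half_shell.
have [//|wBx] := leP (w x) (B x).
have := maxc x (mem_set Kx); rewrite /= => xc.
have wBc : 0 < w c - B c by apply: lt_le_trans xc; rewrite subr_gt0.
have nb : ~ [\/ xlast c = h, enorm c = r | enorm c = M].
  move=> bc; have := bnd c Kc.1 Kc.2 bc; rewrite -subr_ge0 -opprB oppr_ge0.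
  by rewrite leNgt wBc.
have [hc /andP[rc cM]] := Kc.
have hc' : h < xlast c by rewrite lt_neqAle hc andbT; apply/eqP => E; apply: nb; constructor 1.
have rc' : r < enorm c by rewrite lt_neqAle rc andbT; apply/eqP => E; apply: nb; constructor 2.
have cM' : enorm c < M by rewrite lt_neqAle cM andbT; apply/eqP => E; apply: nb; constructor 3.
exfalso; apply: (noloc c) => //.
have n1 : \forall y \near c, h < xlast y.
  exact: (cvgr_gt _ (@xlast_continuous c) _ hc').
have n2 : \forall y \near c, r < enorm y.
  exact: (cvgr_gt _ (@enorm_continuous _ c) _ rc').
have n3 : \forall y \near c, enorm y < M.
  exact: (cvgr_lt _ (@enorm_continuous _ c) _ cM').
near=> y; apply: maxc; apply/mem_set; split; first by apply: ltW; near: y.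
by apply/andP; split; apply: ltW; near: y.
Unshelve. all: by end_near. Qed.

Lemma xlast_line (t : R) z : xlast (t *: evec ord_max + z) = t + xlast z.
Proof. by rewrite /xlast /evec !mxE !eqxx/= mulr1. Qed.

Lemma lift_line (t : R) z (i : 'I_m) :
  (t *: evec ord_max + z) 0 (lift ord_max i) = z 0 (lift ord_max i).
Proof. by rewrite /evec !mxE eq_sym (negPf (neq_lift _ _)) andbF mulr0 add0r. Qed.

(** Upward motion from a point with x_n nonnegative never re-enters the ball, because the cross term
    is nonnegative. *)
Lemma enorm_line (t : R) z : 0 <= t -> 0 <= xlast z ->
  enorm z ^+ 2 + t ^+ 2 <= enorm (t *: evec ord_max + z) ^+ 2.
Proof.
move=> t0 z0; rewrite !sqr_enorm_split xlast_line.
under [in leRHS]eq_bigr do rewrite lift_line.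
rewrite -addrA lerD2l sqrrD addrC [leRHS]addrAC -!addrA lerD2l lerDl.
by rewrite mulrn_wge0// mulr_ge0.
Qed.

(** This is the mean value theorem on an upward segment. The starting point may lie on the floor or
    on the unit sphere: [Du] is a derivative only for t > 0, and continuity up to the boundary
    handles t = 0. *)
Lemma vertical_increment u Du z (T K : R) : C1_closed (ext_closed 1) u Du ->
  ext_closed 1 z -> 0 <= T ->
  (forall t, 0 < t < T -> enorm (Du (t *: evec ord_max + z)) <= K) ->
  `|u (T *: evec ord_max + z) - u z| <= K * T.
Proof.
move=> [cu _ du] [z0 z1] T0 DuK.
have [->|Tn0] := eqVneq T 0; first by rewrite scale0r add0r subrr normr0 mulr0.
have T1 : 0 < T by rewrite lt_neqAle eq_sym Tn0.
have in1 t : 0 < t -> 1 < enorm (t *: evec ord_max + z).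
  move=> t0; have := enorm_line (ltW t0) z0.
  rewrite -ltr_sqr ?nnegrE ?enorm_ge0//; apply: lt_le_trans.
  by rewrite expr1n ltr_pwDr ?exprn_gt0 ?exprn_ege1.
have lc : continuous (fun t : R => t *: evec ord_max + z).
  move=> t; apply: (@cvgD _ _ _ _ _ ( *:%R^~ (evec ord_max)) (cst z)).
    exact: scalel_continuous.
  exact: cvg_cst.
have cf : {within `[0, T], continuous (fun t : R => u (t *: evec ord_max + z))}.
  apply/subspace_continuousP => t; rewrite /= in_itv/= => /andP[t0 tT].
  have Et (r : R) : 0 <= r -> ext_closed 1 (r *: evec ord_max + z).
    rewrite le_eqVlt => /orP[/eqP <-|r0]; first by rewrite scale0r add0r.
    split; last by exact/ltW/in1.
    by rewrite xlast_line addr_ge0// ltW.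
  move/subspace_continuousP : cu => /(_ _ (Et _ t0)) cu P /cu /= n1.
  apply: (@filterS _ (nbhs t) _ _ _ _ (lc t _ n1)) => y /= HP.
  by rewrite in_itv/= => /andP[y0 _]; apply: HP; exact: Et.
have [|c] := @MVT R _ (fun t => Du (t *: evec ord_max + z) 0 ord_max) _ _ T1 _ cf.
  move=> t; rewrite in_itv/= => /andP[t0 _]; apply: is_derive_line; apply: du.
  apply: ext_closed_interior; last exact: in1.
  by rewrite /half_space/= xlast_line ltr_pwDl.
rewrite scale0r add0r subr0 in_itv/= => /DuK DuKc ->.
rewrite normrM (gtr0_norm T1) ler_wpM2r//.
exact: le_trans (coord_le_enorm _ _) DuKc.
Qed.

End HalfSpaceGeometry.

(** * Growth of the solution along vertical lines, and comparison of rho with |x| *)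

Section Growth.
Context {R : realType} {m : nat}.
Implicit Types (x z : 'rV[R]_m.+1) (u : 'rV[R]_m.+1 -> R).

Definition floor_proj x : 'rV[R]_m.+1 := - xlast x *: evec ord_max + x.

Lemma xlast_floor_proj x : xlast (floor_proj x) = 0.
Proof. by rewrite xlast_line addNr. Qed.

Lemma floor_projK x t :
  x = (xlast x - t) *: evec ord_max + (t *: evec ord_max + floor_proj x).
Proof. by rewrite /floor_proj !addrA -!scalerDl subrK subrr scale0r add0r. Qed.

Lemma sqr_enorm_floor_proj x t :
  enorm (t *: evec ord_max + floor_proj x) ^+ 2 =
  \sum_(i < m) x 0 (lift ord_max i) ^+ 2 + t ^+ 2.
Proof.
rewrite sqr_enorm_split xlast_line xlast_floor_proj addr0.
by under eq_bigr do rewrite !lift_line.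
Qed.

Lemma sqr_le_enorm x (c : R) : 0 <= c -> (c <= enorm x) = (c ^+ 2 <= enorm x ^+ 2).
Proof. by move=> c0; rewrite ler_sqr ?nnegrE ?enorm_ge0. Qed.

(** Integration starts at the floor, where [u] vanishes, if |x'| is at least 1, and otherwise at the
    point of the unit sphere on the same vertical line, where |u| is at most 1. In the latter case
    |x| at least 2 forces x_n at least 1, which absorbs that 1. *)
Lemma linear_growth u Du : C1_closed (ext_closed 1) u Du ->
  (forall x, xlast x = 0 -> 1 <= enorm x -> u x = 0) ->
  (forall x, enorm x = 1 -> 0 < xlast x -> `|u x| <= 1) ->
  (forall x, ext_closed 1 x -> enorm (Du x) <= 1) ->
  forall x, 0 <= xlast x -> 2 <= enorm x -> `|u x| <= 2 * xlast x.
Proof.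
move=> uC1 u0 u1 Du1 x x0; rewrite sqr_le_enorm// sqr_enorm_split => x2.
set S := \sum_(i < m) _ in x2.
have S0 : 0 <= S by apply: sumr_ge0 => i _; exact: sqr_ge0.
have step t : 0 <= t -> t <= xlast x -> 1 <= S + t ^+ 2 ->
    `|u x| <= `|u (t *: evec ord_max + floor_proj x)| + (xlast x - t).
  move=> t0 tx St; rewrite -lerBlDl.
  apply: le_trans (lerB_dist _ _) _.
  rewrite {1}(floor_projK x t) -[leRHS]mul1r.
  have zE : ext_closed 1 (t *: evec ord_max + floor_proj x).
    split; first by rewrite xlast_line xlast_floor_proj addr0.
    by rewrite sqr_le_enorm// sqr_enorm_floor_proj expr1n.
  apply: (vertical_increment uC1 zE); first by rewrite subr_ge0.
  move=> r /andP[r0 _]; apply: Du1; split.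
    by rewrite 2!xlast_line xlast_floor_proj addr0 addr_ge0// ltW.
  have := enorm_line (ltW r0) zE.1; rewrite sqr_le_enorm// expr1n; apply: le_trans.
  by rewrite sqr_enorm_floor_proj ler_wpDr// sqr_ge0.
have [S1|S1] := leP 1 S.
  apply: le_trans (step 0 _ _ _) _ => //; first by rewrite expr0n addr0.
  rewrite u0; first by rewrite normr0 add0r subr0; lra.
    by rewrite xlast_line xlast_floor_proj addr0.
  by rewrite sqr_le_enorm// sqr_enorm_floor_proj expr1n expr0n addr0.
have x1 : 1 <= xlast x by rewrite -(@ler_sqr R) ?nnegrE// expr1n; lra.
have t1 : Num.sqrt (1 - S) ^+ 2 = 1 - S by rewrite sqr_sqrtr// subr_ge0 ltW.
have t0 : 0 < Num.sqrt (1 - S) by rewrite sqrtr_gt0 subr_gt0.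
apply: le_trans (step (Num.sqrt (1 - S)) (ltW t0) _ _) _.
- by rewrite -(@ler_sqr R) ?nnegrE ?sqrtr_ge0// t1; lra.
- by rewrite t1; lra.
have : `|u (Num.sqrt (1 - S) *: evec ord_max + floor_proj x)| <= 1.
  apply: u1; last by rewrite xlast_line xlast_floor_proj addr0.
  apply/eqP; rewrite -(@eqrXn2 _ 2)// ?enorm_ge0//.
  by rewrite sqr_enorm_floor_proj t1 expr1n addrCA subrr addr0.
move: (Num.sqrt _) (u _) t0 => t v; lra.
Qed.

(** Beyond radius [M1] the gradient is below e/2. Integration starts at the floor if |x'| is at
    least [M1], and at height [M1] otherwise, where the linear bound gives |u| at most 2 M1. *)
Lemma sublinear_growth u Du : C1_closed (ext_closed 1) u Du ->
  (forall x, xlast x = 0 -> 1 <= enorm x -> u x = 0) ->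
  (forall x, 0 <= xlast x -> 2 <= enorm x -> `|u x| <= 2 * xlast x) ->
  (forall e : R, 0 < e -> exists M, forall x,
     ext_closed 1 x -> M <= enorm x -> enorm (Du x) < e) ->
  forall e : R, 0 < e -> exists M, forall x,
    0 <= xlast x -> M <= enorm x -> `|u x| <= e * xlast x.
Proof.
move=> uC1 u0 u2 Duoo e e0; have e20 : 0 < e / 2 by rewrite divr_gt0.
have [M0 DuM0] := Duoo _ e20.
pose M1 := Num.max M0 2.
have M12 : 2 <= M1 by rewrite le_max lexx orbT.
have M10 : 0 <= M1 by apply: le_trans M12.
have Me0 : 0 <= 4 * M1 / e by rewrite divr_ge0 ?mulr_ge0// ltW.
(* If |x'| < M1, this radius forces x_n to be at least M1 + 4 M1/e, so the starting value 2 M1 is at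
   most (e/2) x_n. *)
exists (2 * M1 + 4 * M1 / e) => x x0; rewrite sqr_le_enorm; last first.
  by rewrite addr_ge0// mulr_ge0.
rewrite sqr_enorm_split => xM; set S := \sum_(i < m) _ in xM.
have S0 : 0 <= S by apply: sumr_ge0 => i _; exact: sqr_ge0.
have step t : 0 <= t -> t <= xlast x -> M1 ^+ 2 <= S + t ^+ 2 ->
    `|u x| <= `|u (t *: evec ord_max + floor_proj x)| + e / 2 * (xlast x - t).
  move=> t0 tx St; rewrite -lerBlDl.
  apply: le_trans (lerB_dist _ _) _.
  rewrite {1}(floor_projK x t).
  have zM : M1 <= enorm (t *: evec ord_max + floor_proj x).
    by rewrite sqr_le_enorm// sqr_enorm_floor_proj.
  have zE : ext_closed 1 (t *: evec ord_max + floor_proj x).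
    split; first by rewrite xlast_line xlast_floor_proj addr0.
    by apply: le_trans zM; lra.
  apply: (vertical_increment uC1 zE); first by rewrite subr_ge0.
  move=> r /andP[r0 _]; apply: ltW.
  have zr : M1 <= enorm (r *: evec ord_max + (t *: evec ord_max + floor_proj x)).
    have := enorm_line (ltW r0) zE.1; rewrite sqr_le_enorm//; apply: le_trans.
    by rewrite sqr_enorm_floor_proj ler_wpDr// sqr_ge0.
  apply: DuM0; last by apply: le_trans zr; rewrite le_max lexx.
  split; last by apply: le_trans zr; lra.
  by rewrite 2!xlast_line xlast_floor_proj addr0 addr_ge0// ltW.
have [S1|S1] := leP (M1 ^+ 2) S.
  apply: le_trans (step 0 _ _ _) _ => //; first by rewrite expr0n addr0.
  rewrite u0; first by rewrite normr0 add0r subr0 ler_wpM2r//; lra.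
    by rewrite xlast_line xlast_floor_proj addr0.
  rewrite sqr_le_enorm// sqr_enorm_floor_proj expr1n expr0n addr0.
  by apply: le_trans S1; rewrite exprn_ege1//; lra.
have xM1 : M1 + 4 * M1 / e <= xlast x.
  rewrite -(@ler_sqr R) ?nnegrE ?addr_ge0//.
  move: Me0 xM; move: (4 * M1 / e) => d d0; rewrite !expr2 in S1 *; nra.
apply: le_trans (step M1 M10 _ _) _; [lra|by rewrite lerDr|].
have := u2 (M1 *: evec ord_max + floor_proj x).
rewrite xlast_line xlast_floor_proj addr0 => /(_ M10) u2M.
have {}u2M : `|u (M1 *: evec ord_max + floor_proj x)| <= 2 * M1.
  apply: u2M; apply: le_trans M12 _.
  by rewrite sqr_le_enorm// sqr_enorm_floor_proj lerDr.
have : 4 * M1 / e <= xlast x by lra.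
rewrite ler_pdivrMr// => xe; apply: le_trans (lerD u2M (lexx _)) _.
have : 0 <= e * M1 by rewrite mulr_ge0// ltW.
lra.
Qed.

(** Either |x'|^2 is at least half of |x|^2, or x_n is at least 1 and x_n^(2g) dominates x_n^2. *)
Lemma rho_ge (g : R) x : 1 <= g -> 0 <= xlast x -> 2 <= enorm x ->
  enorm x ^+ 2 / (2 * g ^+ 2) <= rho g x.
Proof.
move=> g1 x0; rewrite sqr_le_enorm// sqr_enorm_split /rho.
set S := \sum_(i < m) _ => x2.
have S0 : 0 <= S by apply: sumr_ge0 => i _; exact: sqr_ge0.
have g0 : 0 < g := lt_le_trans ltr01 g1.
have g21 : 1 <= g ^+ 2 by rewrite exprn_ege1.
rewrite ler_pdivrMr ?mulr_gt0//.
have -> : (S + (g ^+ 2)^-1 * xlast x `^ (2 * g)) * (2 * g ^+ 2) =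
    2 * (S * g ^+ 2) + 2 * xlast x `^ (2 * g).
  by field; rewrite gt_eqF.
have P0 := powR_ge0 (xlast x) (2 * g).
have SgS : S <= S * g ^+ 2 by rewrite ler_peMr.
have [h|h] := leP (xlast x ^+ 2) S; first by move: h SgS P0; lra.
have x1 : 1 <= xlast x by rewrite -(@ler_sqr R) ?nnegrE// expr1n; lra.
have : xlast x ^+ 2 <= xlast x `^ (2 * g).
  by rewrite -powR_mulrn// ler_powR//; lra.
lra.
Qed.

Lemma rho_le (g : R) x : 1 <= g -> 0 <= xlast x ->
  rho g x <= enorm x ^+ 2 + enorm x `^ (2 * g).
Proof.
move=> g1 x0; rewrite /rho lerD//.
  by rewrite sqr_enorm_split lerDl sqr_ge0.
apply: le_trans (_ : 1 * xlast x `^ (2 * g) <= _).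
  by rewrite ler_wpM2r ?powR_ge0// invf_le1 ?exprn_gt0 ?exprn_ege1//; lra.
rewrite mul1r ge0_ler_powR ?nnegrE ?enorm_ge0//; first by lra.
by apply: le_trans (ler_norm _) _; exact: coord_le_enorm.
Qed.

End Growth.

(** * Test functions and exclusion of interior contact *)

Section Comparison.
Context {R : realType} {m : nat}.
Implicit Types (x : 'rV[R]_m.+1) (u : 'rV[R]_m.+1 -> R).

Lemma smooth_uptoZ n (c : R) (f : 'rV[R]_m.+1 -> R) :
  smooth_upto n f -> smooth_upto n (c \*: f).
Proof. by move=> sf; exact: (smooth_uptoM (smooth_upto_cst n c) sf). Qed.

(* For c, e, h > 0 this lies above the solution; its opposite, of the same
   form, lies below. *)
Definition test_function (g p k q c e h : R) : 'rV[R]_m.+1 -> R :=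
  c \*: (monomial g 1 (- p) \+ (-1) \*: monomial g k (- q))
  \+ (e \*: xlast \+ cst h).

Lemma smooth_upto_test n (g p k q c e h : R) (g0 : 0 < g) :
  smooth_upto n (test_function g p k q c e h).
Proof.
apply: smooth_uptoD.
  apply: smooth_uptoZ; apply: smooth_uptoD; first exact: smooth_upto_monomial.
  by apply: smooth_uptoZ; exact: smooth_upto_monomial.
apply: smooth_uptoD; last exact: smooth_upto_cst.
by apply: smooth_uptoZ; exact: smooth_upto_coord.
Qed.

Lemma Lop_test alpha (a : 'I_m -> 'I_m -> 'rV[R]_m.+1 -> R)
    (b : 'I_m -> 'rV[R]_m.+1 -> R) (g p k q c e h : R) x :
  0 < g -> half_space x ->
  Lop alpha a b (test_function g p k q c e h) x =
  c * (Lop alpha a b (monomial g 1 (- p)) x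
       - Lop alpha a b (monomial g k (- q)) x).
Proof.
move=> g0 Hx.
have s1 := @smooth_upto_monomial R m 2 g 1 (- p) g0.
have s2 := @smooth_upto_monomial R m 2 g k (- q) g0.
have s2' := smooth_uptoZ (-1) s2.
have sx : smooth_upto 2 (@xlast R m) by exact: smooth_upto_coord.
have sc := @smooth_upto_cst R m 2 h.
have s12 := smooth_uptoD s1 s2'.
have sxc := smooth_uptoD (smooth_uptoZ e sx) sc.
rewrite (LopD _ _ _ (smooth_uptoZ c s12) sxc Hx) (LopZ _ _ _ _ s12 Hx).
rewrite (LopD _ _ _ s1 s2' Hx) (LopZ _ _ _ _ s2 Hx).
rewrite (LopD _ _ _ (smooth_uptoZ e sx) sc Hx) (LopZ _ _ _ _ sx Hx).
rewrite (@Lop_eq0 _ _ _ _ _ xlast) => [|i j]; last exact: pderiv2_coord.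
rewrite (@Lop_eq0 _ _ _ _ _ (cst h)) => [|i j]; last exact: pderiv2_cst.
by rewrite mulr0 !addr0 mulN1r.
Qed.

Lemma test_functionE (g p k q c e h : R) x :
  test_function g p k q c e h x =
  c * (monomial g 1 (- p) x - monomial g k (- q) x) + (e * xlast x + h).
Proof. by rewrite /test_function/= /GRing.scale/= mulN1r. Qed.

Lemma test_functionN (g p k q c e h : R) x :
  test_function g p k q (- c) (- e) (- h) x = - test_function g p k q c e h x.
Proof. rewrite !test_functionE; ring. Qed.

(** The affine part of the test function is annihilated, so the operator is strictly negative on it,
    whereas contact from above would make it nonnegative. The sign [sg] treats [u] and [- u]
    together. *)
Lemma no_contact alpha (a : 'I_m -> 'I_m -> 'rV[R]_m.+1 -> R)
    (b : 'I_m -> 'rV[R]_m.+1 -> R) u (g p k q c e h : R) x :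
  0 < g -> 0 < c -> viscosity_solution alpha a b ext_domain u -> ext_domain x ->
  Lop alpha a b (monomial g 1 (- p)) x < Lop alpha a b (monomial g k (- q)) x ->
  forall sg : bool, let w := fun y => (-1) ^+ sg * u y in
  ~ (\forall y \near x, w y - test_function g p k q c e h y
                        <= w x - test_function g p k q c e h x).
Proof.
move=> g0 c0 [_ sub super] Dx LL sg w; have Hx := Dx.1.
have C2t c' e' h' : C2 ext_domain (test_function g p k q c' e' h').
  by apply: smooth_upto_C2; [move=> y []|exact: smooth_upto_test].
rewrite /w; case: sg {w} => near_max.
  (* A local maximum of -u - B is a local minimum of u - (-B), so the supersolution property is
     tested with -B. *)
  have : Lop alpha a b (test_function g p k q (- c) (- e) (- h)) x <= 0.
    apply: super => //; near=> y.
    have : (-1) ^+ true * u y - test_function g p k q c e h y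
           <= (-1) ^+ true * u x - test_function g p k q c e h x by near: y.
    by rewrite !test_functionN expr1 !mulN1r -!opprD lerN2 !opprK.
  rewrite Lop_test// leNgt mulNr oppr_gt0 pmulr_rlt0// subr_lt0.
  by rewrite LL.
have : 0 <= Lop alpha a b (test_function g p k q c e h) x.
  apply: sub => //; near=> y.
  have : (-1) ^+ false * u y - test_function g p k q c e h y
         <= (-1) ^+ false * u x - test_function g p k q c e h x by near: y.
  by rewrite expr0 !mul1r.
by rewrite Lop_test// leNgt pmulr_rlt0// subr_lt0 LL.
Unshelve. all: by end_near. Qed.

End Comparison.

(** * Choice of the constants and the decay estimate *)

Theorem theorem1p2 (R : realType) (m : nat) (hm : (1 <= m)%N)
    (alpha delta s : R) (halpha : 0 < alpha) (hdelta : 0 < delta < 1)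
    (hs : 0 < s) :
  exists C r0 : R, 0 < C /\ 1 <= r0 /\
  forall (lambda Lambda : R)
    (a : 'I_m -> 'I_m -> 'rV[R]_m.+1 -> R) (b : 'I_m -> 'rV[R]_m.+1 -> R)
    (u : 'rV[R]_m.+1 -> R) (Du : 'rV[R]_m.+1 -> 'rV[R]_m.+1),
    0 < lambda -> lambda <= Lambda ->
    (forall i j, {within half_space, continuous (a i j)}) ->
    (forall i, {within half_space, continuous (b i)}) ->
    (forall (x : 'rV[R]_m.+1) (xi : 'rV[R]_m), half_space x ->
       lambda * enorm xi ^+ 2
         <= \sum_(i < m) \sum_(j < m) a i j x * xi 0 i * xi 0 j
         <= Lambda * enorm xi ^+ 2) ->
    (delta%:E < 1 - lambda^-1%:E *
       \sum_(i < m) Linfty_norm half_space (b i) ^+ 2)%E ->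
    (forall x i j, ext_domain x ->
       `|a i j x - (i == j)%:R| + `|b i x| <= gauge alpha x `^ (- s)) ->
    C1_closed (ext_closed 1) u Du ->
    viscosity_solution alpha a b ext_domain u ->
    (forall x, xlast x = 0 -> 1 <= enorm x -> u x = 0) ->
    (forall x, enorm x = 1 -> 0 < xlast x -> `|u x| <= 1) ->
    (forall x, ext_closed 1 x -> enorm (Du x) <= 1) ->
    (forall e, 0 < e -> exists M, forall x,
       ext_closed 1 x -> M <= enorm x -> enorm (Du x) < e) ->
    forall x, 0 <= xlast x -> r0 <= enorm x ->
      `|u x| <= C * xlast x / gauge alpha x `^ hom_dim m alpha.
Proof.
pose g := alpha + 1; have g1 : 1 <= g by rewrite lerDr ltW.
have g0 : 0 < g := lt_le_trans ltr01 g1.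
(* This ensures both [theta < s] and [theta <= g], since [g >= 1]. *)
pose theta := Num.min s 1 / 2.
have th0 : 0 < theta by rewrite divr_gt0// lt_min hs ltr01.
have ths : theta < s.
  have : Num.min s 1 <= s by rewrite ge_min lexx.
  by move: th0; rewrite /theta; lra.
have thg : theta <= g.
  have : Num.min s 1 <= 1 by rewrite ge_min lexx orbT.
  by move: g1; rewrite /theta; lra.
pose p := hom_dim m alpha / (2 * g); pose q := p + theta / g.
have [rho0 rho01 barrier] := @barrier_inequalities R m _ _ _ halpha th0 ths thg.
rewrite -/g -/p -/q in barrier.
(* The 2 serves the growth bounds; the other term makes r0^2/(2 g^2) at least [rho0], so by [rho_ge]
   the barrier works outside radius [r0]. *)
pose r0 : R := 2 + 2 * g ^+ 2 * rho0.
have gr0 : 0 <= 2 * g ^+ 2 * rho0.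
  by rewrite !mulr_ge0 ?(ltW g0)//; apply: le_trans rho01.
have r02 : 2 <= r0 by rewrite lerDl.
pose rho1 := r0 ^+ 2 + r0 `^ (2 * g).
have rho10 : 0 < rho1.
  by rewrite ltr_pwDl ?exprn_gt0 ?powR_ge0//; lra.
have p0 : 0 <= p.
  by rewrite divr_ge0 ?mulr_ge0 ?(ltW g0)// addr_ge0// mulr_ge0// ltW.
(* As [rho1] bounds rho on |x| = r0, there 2 x_n is at most half of C x_n rho^(-p), hence at most C
   v. *)
exists (4 * rho1 `^ p), r0; split; first by rewrite mulr_gt0 ?powR_gt0.
split; first by lra.
move=> lambda Lambda a b u Du _ _ _ _ _ _ ab uC1 visc u0 u1 Du1 Duoo x x0 xr.
set C := 4 * _; have C0 : 0 < C by rewrite mulr_gt0 ?powR_gt0.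
have [x00|xn0] := eqVneq (xlast x) 0.
  by rewrite u0// ?x00 ?mulr0 ?mul0r ?normr0//; lra.
have Hx : half_space x by rewrite /half_space/= lt_neqAle eq_sym xn0.
have lin := linear_growth uC1 u0 u1 Du1.
have sublin := sublinear_growth uC1 u0 lin Duoo.
have rho_large (y : 'rV[R]_m.+1) : half_space y -> r0 <= enorm y -> rho0 <= rho g y.
  move=> Hy ry; apply: le_trans (rho_ge g1 (ltW Hy) (le_trans r02 ry)).
  rewrite ler_pdivlMr ?mulr_gt0 ?exprn_gt0//.
  have : r0 ^+ 2 <= enorm y ^+ 2 by rewrite -sqr_le_enorm//; lra.
  apply: le_trans; rewrite /r0 mulrC; move: gr0; move: (_ * rho0) => G G0; nra.
have dom (y : 'rV[R]_m.+1) : half_space y -> r0 <= enorm y -> ext_domain y.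
  by move=> Hy ry; apply: outside_ball_ext_domain => //; lra.
have -> : gauge alpha x `^ hom_dim m alpha = rho g x `^ p.
  by rewrite gaugeE -powRrM mulrC.
(* The additive constant is [2 * h] because the linear bound gives |u| at most 2h on the face x_n =
   h. *)
have bound (sg : bool) (e h : R) : 0 < e -> 0 < h -> h <= xlast x ->
    (-1) ^+ sg * u x <= C * monomial g 1 (- p) x + (e * xlast x + 2 * h).
  move=> e0 h0 hx; have [M HM] := sublin e e0.
  have wu y : (-1) ^+ sg * u y <= `|u y|.
    by apply: le_trans (ler_norm _) _; rewrite normrM normr_sign mul1r.
  apply: (@le_trans _ _ (test_function g p (1 + theta) q C e (2 * h) x)); last first.
    rewrite test_functionE lerD2r ler_wpM2l ?(ltW C0)// gerBl.
    by rewrite ltW// monomial_gt0.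
  (* The outer radius must enclose [x] and also reach the range where |u| is at most e x_n. *)
  pose M' := Num.max M (enorm x).
  have cB := smooth_upto_continuous
    (@smooth_upto_test R m 0 g p (1 + theta) q C e (2 * h) g0).
  apply: (@half_shell_comparison _ _ (fun y => (-1) ^+ sg * u y)
    (test_function g p (1 + theta) q C e (2 * h)) h r0 M' h0 _ _ cB).
  - by lra.
  - have [cu _ _] := visc; apply/subspace_continuousP => y Dy.
    apply: cvgM; first exact: cvg_cst.
    by move/subspace_continuousP: cu; exact.
  - move=> y hy /andP[ry yM] bdry; apply: le_trans (wu y) _.
    have Hy : half_space y by apply: lt_le_trans hy.
    have [half _] := barrier y Hy (rho_large y Hy ry).
    have ey0 : 0 <= e * xlast y by rewrite mulr_ge0// ltW.
    have F0 := monomial_gt0 1 (- p) g0 Hy.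
    have CF : C * (monomial g 1 (- p) y / 2) <=
        C * (monomial g 1 (- p) y - monomial g (1 + theta) (- q) y).
      by rewrite ler_wpM2l ?(ltW C0)//; lra.
    have CF0 : 0 <= C * (monomial g 1 (- p) y / 2).
      by rewrite mulr_ge0 ?divr_ge0// ltW.
    rewrite test_functionE.
    have u2 := lin y (ltW Hy) (le_trans r02 ry).
    case: bdry => [yh|yr|yM'].
    + by rewrite yh in u2 ey0 *; lra.
    + have : rho g y <= rho1 by rewrite /rho1 -yr; exact: rho_le (ltW Hy).
      move=> rr; have : 2 * xlast y <= C * (monomial g 1 (- p) y / 2).
        have ry0 := rho_gt0 g0 Hy.
        rewrite /C /monomial powRr1 ?(ltW Hy)// powRN.
        have -> : 4 * rho1 `^ p * (xlast y / rho g y `^ p / 2) =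
          2 * xlast y * (rho1 `^ p / rho g y `^ p).
          by field; rewrite gt_eqF// powR_gt0.
        rewrite ler_peMr ?mulr_ge0 ?(ltW Hy)// ler_pdivlMr ?powR_gt0// mul1r.
        by rewrite ge0_ler_powR ?nnegrE ?(ltW ry0) ?(ltW rho10).
      by lra.
    + have := HM y (ltW Hy); rewrite yM' le_max lexx => /(_ isT); lra.
  - move=> y hy ry; have Hy : half_space y by apply: lt_trans hy.
    have [_ LL] := barrier y Hy (rho_large y Hy (ltW ry)).
    apply: (no_contact g0 C0 visc (dom y Hy (ltW ry))).
    by apply: LL => i j; apply: ab; exact: dom (ltW ry).
  - exact: hx.
  - by rewrite xr le_max lexx orbT.
have -> : C * xlast x / rho g x `^ p = C * monomial g 1 (- p) x.
  by rewrite /monomial powRr1// powRN mulrA.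
have sided (sg : bool) : (-1) ^+ sg * u x <= C * monomial g 1 (- p) x.
  apply/ler_addgt0Pr => e e0.
  (* The slope contributes e/2 at [x], and twice the height at most another e/2; the minimum with
     [xlast x] keeps [x] in the shell. *)
  have e1 : 0 < e / 2 / xlast x by rewrite !divr_gt0.
  have h1 : 0 < Num.min (xlast x) (e / 4) by rewrite lt_min Hx divr_gt0.
  have h2 : Num.min (xlast x) (e / 4) <= xlast x by rewrite ge_min lexx.
  have h3 : Num.min (xlast x) (e / 4) <= e / 4 by rewrite ge_min lexx orbT.
  apply: le_trans (bound sg _ _ e1 h1 h2) _.
  rewrite lerD2l divfK//; lra.
have := sided true; have := sided false.
by rewrite ler_norml expr0 expr1 mul1r mulN1r => -> ?; rewrite lerNl andbT.
Qed.
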